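(* For integers $p,q,m\geq 2$, \begin{align*} &(-1)^{m} \sum_{\substack{i+j=p-1\\ i,j\geq 0}} \binom{m+i-1}{i}\binom{q+j-1}{j}T(m+i,q+j)+(-1)^{p} \sum_{\substack{i+j=m-1\\ i,j\geq 0}} \binom{p+i-1}{i}\binom{q+j-1}{j} T(p+i,q+j)\\ &=\frac{1}{2^{p+q+m-3}}\binom{p+q+m-2}{q-1}\widetilde{t}(p+q+m-1)\\ &\quad+\frac{1}{2^{p+q+m-3}}\sum_{\substack{i+j=p-1\\ i,j\geq 0}} \binom{m+i-1}{i}\binom{q+j-1}{j} \left((-1)^i+(-1)^m \right) \zeta(m+i)\widetilde{t}(q+j)\\ &\quad+\frac{1}{2^{p+q+m-3}} \sum_{\substack{i+j=m-1\\ i,j\geq 0}} \binom{p+i-1}{i}\binom{q+j-1}{j} \left((-1)^i+(-1)^p \right) \zeta(p+i)\widetilde{t}(q+j)\\ &\quad-\frac{1}{2^{p+q+m-3}}\sum_{\substack{i+j=q-1\\ i,j\geq 0}} \binom{m+i-1}{i}\binom{p+j-1}{j} \widetilde{t}(m+i)\widetilde{t}(p+j). \end{align*}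
   Context: The double Kaneko–Tsumura $T$-value is $T(k_1,k_2)=4\sum_{n_1>n_2>0}\frac{1}{(2n_1-2)^{k_1}(2n_2-1)^{k_2}}$ for positive integers $k_1>1$, $k_2$. For $s>1$, $\widetilde t(s)=\sum_{n\ge1}(n-1/2)^{-s}=(2^s-1)\zeta(s)$; $\zeta$ is the Riemann zeta function. *)

(* Defs.v *)
From mathcomp Require Import all_boot all_order all_algebra.
From mathcomp Require Import all_classical all_reals all_analysis.

Set Implicit Arguments.
Unset Strict Implicit.
Unset Printing Implicit Defensive.

Import Order.TTheory GRing.Theory Num.Theory.
Import numFieldNormedType.Exports.

Local Open Scope classical_set_scope.
Local Open Scope ring_scope.

(* The Riemann zeta function on its half-line of convergence s > 1. *)
Definition zeta (R : realType) (s : R) : R :=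
  \big[+%R/0]_(1 <= n <oo) n%:R `^ (- s).

(* Meaningful for s > 1 only. *)
Definition ttilde (R : realType) (s : R) : R :=
  \big[+%R/0]_(1 <= n <oo) (n%:R - 2^-1) `^ (- s).

(* The index set is {n1 > n2 > 0} with n = (n1, n2). All terms are
   nonnegative, and the sum is finite when k1 > 1 and k2 > 0. *)
Definition doubleT (R : realType) (k1 k2 : nat) : R :=
  4 * fine (\esum_(n in [set n : nat * nat | (0 < n.2 < n.1)%N])
              (((2 * n.1%:R - 2) ^+ k1 * (2 * n.2%:R - 1) ^+ k2)^-1)%:E).

(* Main.v *)
Require Import Defs.
From mathcomp Require Import all_boot all_order all_algebra.
From mathcomp Require Import ring lra zify.
From mathcomp Require Import all_classical all_reals all_analysis.

(* For x = a + y, the residues of the rational function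
   z^-p (z - a)^-m (z - x)^-q at 0, a and x add up to 0. Summing this identity
   over all integers a > 0 and half-integers y > 0, the residue at 0 gives the
   part a < x of the products zeta * ttilde, that is, zeta * ttilde minus a
   double T-value; the residue at a gives products zeta * ttilde; and the residue
   at x gives the part y < x of the products ttilde * ttilde. Exchanging p and m
   gives the part y > x, and the diagonal y = x, counted by a Vandermonde
   convolution of binomials, gives ttilde (p + q + m - 1). *)

Set Implicit Arguments.
Unset Strict Implicit.
Unset Printing Implicit Defensive.

Import Order.TTheory GRing.Theory Num.Theory.
Import numFieldNormedType.Exports.

Local Open Scope ring_scope.

(** * Partial fractions and convolutions of binomials *)

Section PartialFractions.
Variable F : fieldType.
Implicit Types (c d : F) (k r s : nat).

(* The coefficient of z^(k-1) in (c - z)^-r (d - z)^-s; truncated subtraction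
   gives the right binomials when [r] or [s] is 0. *)
Definition pfcoef k c r d s : F :=
  \sum_(i < k) 'C(r + i - 1, i)%:R * 'C(s + (k - 1 - i) - 1, k - 1 - i)%:R
    * (c ^- (r + i) * d ^- (s + (k - 1 - i))).

Lemma pfcoef0 c r d s : pfcoef 0 c r d s = 0.
Proof. exact: big_ord0. Qed.

Lemma pfcoefC k c r d s : pfcoef k c r d s = pfcoef k d s c r.
Proof.
rewrite /pfcoef (reindex_inj rev_ord_inj) /=; apply: eq_bigr => i _.
have -> : (k - i.+1 = k - 1 - i)%N by lia.
have -> : (k - 1 - (k - 1 - i) = i)%N by have := ltn_ord i; lia.
by rewrite [X in X * _ = _]mulrC [X in _ * X = _]mulrC.
Qed.

Lemma pfcoef_r0 k c d s :
  pfcoef k.+1 c 0 d s = 'C(s + k - 1, k)%:R * d ^- (s + k).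
Proof.
rewrite /pfcoef big_ord_recl big1 => [|i _]; last first.
  by rewrite add0n /= bin_small ?mul0r //; rewrite /bump; lia.
have -> : (k.+1 - 1 - @ord0 k = k)%N by rewrite /=; lia.
by rewrite addr0 add0n bin0 mul1r expr0 invr1 mul1r.
Qed.

Lemma mul_expVS c n : c != 0 -> c * c ^- n.+1 = c ^- n.
Proof. by move=> c0; rewrite exprS invfM mulrA divff // mul1r. Qed.

(** Write [c = (c - z) + z]: the factor [c - z] lowers the exponent [r.+1] to [r], and [z] shifts
    the coefficient by one. Term by term this is Pascal's rule. *)
Lemma pfcoef_recl k c r d s : c != 0 ->
  c * pfcoef k.+1 c r.+1 d s = pfcoef k.+1 c r d s + pfcoef k c r.+1 d s.
Proof.
move=> c0; rewrite /pfcoef big_ord_recl [in RHS]big_ord_recl mulrDr -addrA.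
congr +%R.
  by rewrite /= !bin0 !addn0 mulrCA; congr (_ * _); rewrite mulrA mul_expVS.
rewrite mulr_sumr -big_split; apply: eq_bigr => i _; rewrite /= /bump /= add1n.
have -> : (k.+1 - 1 - i.+1 = k - 1 - i)%N by lia.
have -> : (r.+1 + i.+1 - 1 = (r + i).+1)%N by lia.
have -> : (r + i.+1 - 1 = r + i)%N by lia.
have -> : (r.+1 + i - 1 = r + i)%N by lia.
rewrite binS natrD mulrCA (mulrA c) addSn mul_expVS // addnS addSn.
by rewrite !mulrDl.
Qed.

Lemma pfcoef_recr k c r d s : d != 0 ->
  d * pfcoef k.+1 c r d s.+1 = pfcoef k.+1 c r d s + pfcoef k c r d s.+1.
Proof. by move=> d0; rewrite !(pfcoefC _ c) pfcoef_recl. Qed.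

(* Up to a common sign, the three terms are the residues of
   z^-p (z - a)^-m (z - x)^-q at 0, a and x. *)
Lemma partial_fractions a x y p q m : a != 0 -> x != 0 -> y != 0 ->
    x = a + y -> (1 < q)%N ->
  (-1) ^+ m * pfcoef p a m x q + (-1) ^+ p * pfcoef m (- a) p y q
    = pfcoef q y m x p.
Proof.
move=> a0 x0 y0 xE; case: q => [//|[//|q]] _.
have Na0 : - a != 0 by rewrite oppr_eq0.
elim: p m => [|p IHp] m.
  (* For [p = 0] there is no pole at 0, and for [m > 0] each of the other two terms is a single
     binomial times a power of [y]. *)
  rewrite pfcoef0 mulr0 add0r mul1r.
  case: m => [|m].
    by rewrite pfcoef0 pfcoef_r0 bin_small ?mul0r //=; lia.
  rewrite pfcoef_r0 (pfcoefC _ y) pfcoef_r0.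
  have -> : (q.+2 + m - 1 = q.+1 + m)%N by lia.
  have -> : (m.+1 + q.+1 - 1 = q.+1 + m)%N by lia.
  congr (_%:R * _ ^- _); last by lia.
  by rewrite -[RHS](bin_sub (leq_addr m q.+1)) addKn.
elim: m => [|m IHm].
  rewrite pfcoef0 mulr0 addr0 mul1r !pfcoef_r0.
  have -> : (q.+2 + p - 1 = q.+1 + p)%N by lia.
  have -> : (p.+1 + q.+1 - 1 = q.+1 + p)%N by lia.
  congr (_%:R * _ ^- _); last by lia.
  by rewrite -[RHS](bin_sub (leq_addr p q.+1)) addKn.
(* Since [a / (z (z - a)) = 1 / (z - a) - 1 / z], multiplying by [a] turns each of the three terms
   at [(p+1, m+1)] into its value at [(p, m+1)] minus its value at [(p+1, m)], where the induction
   hypotheses apply. *)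
apply: (mulfI a0).
have -> : a * pfcoef q.+2 y m.+1 x p.+1
    = pfcoef q.+2 y m.+1 x p - pfcoef q.+2 y m x p.+1.
  rewrite (_ : a = x - y); last by rewrite xE addrK.
  by rewrite mulrBl pfcoef_recl // pfcoef_recr //; ring.
rewrite -IHm -IHp mulrDr.
rewrite (mulrCA a) pfcoef_recl //.
rewrite (mulrCA a) -[X in _ * (X * pfcoef m.+1 _ _ _ _)](opprK a) mulNr pfcoef_recl //.
rewrite !exprS; ring.
Qed.

(** At [c = d = 1] the two factors merge into [(1 - z)^-(r + s)]; this yields the Vandermonde
    convolution [sum_bin_mul]. *)
Lemma pfcoef1 k r s :
  pfcoef k.+1 1 r 1 s = 'C(r + s + k - 1, k)%:R.
Proof.
elim: r k => [|r IHr] k.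
  by rewrite pfcoef_r0 expr1n invr1 mulr1.
elim: k => [|k IHk].
  by rewrite /pfcoef big_ord1 !bin0 !expr1n !invr1 !mulr1.
rewrite -[LHS]mul1r pfcoef_recl ?oner_neq0 // IHr IHk.
have -> : (r.+1 + s + k.+1 - 1 = (r + s + k).+1)%N by lia.
by rewrite binS natrD; congr ('C(_,_)%:R + 'C(_,_)%:R); lia.
Qed.

Lemma sum_bin_mul k r s :
  \sum_(i < k.+1) 'C(r + i - 1, i)%:R * 'C(s + (k - i) - 1, k - i)%:R
    = 'C(r + s + k - 1, k)%:R :> F.
Proof.
rewrite -pfcoef1; apply: eq_bigr => i _.
by rewrite !expr1n !invr1 !mulr1 subSS subn0.
Qed.

End PartialFractions.

(** * Absolutely summable real families *)

Section HasSum.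
Local Open Scope classical_set_scope.
Variables (R : realType) (T : choiceType).
Implicit Types (f g h : T -> R) (s : R).

Lemma esumZl (D : set T) (c : R) (a : T -> \bar R) : 0 <= c -> (forall t, 0 <= a t)%E ->
  (\esum_(t in D) (c%:E * a t) = c%:E * \esum_(t in D) a t)%E.
Proof.
move=> c0 a0; rewrite /esum -ereal_supZl //.
  congr ereal_sup; apply/seteqP; split => [_ [A fA <-]|_ [_ [A fA <-] <-]].
    by exists (\sum_(t \in A) a t)%E; [exists A|rewrite ge0_mule_fsumr].
  by exists A => //; rewrite ge0_mule_fsumr.
by apply/set0P; exists 0%E; exists set0 => //; rewrite ?fsbig_set0 //; split.
Qed.

(* [f] is a difference of nonnegative families with finite sums, i.e. [f] is
   absolutely summable; [s] does not depend on the decomposition. *)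
Definition has_sum f s := exists g h (a b : R),
  [/\ forall t, 0 <= g t /\ 0 <= h t, forall t, f t = g t - h t,
    \esum_(t in [set: T]) (g t)%:E = a%:E,
    \esum_(t in [set: T]) (h t)%:E = b%:E & s = a - b].

Lemma eq_has_sum f g s : f =1 g -> has_sum f s -> has_sum g s.
Proof.
move=> fg [u [v [a [b [uv0 fE ua vb sE]]]]].
by exists u, v, a, b; split => // t; rewrite -fg.
Qed.

Lemma has_sum_ge0 f s : (forall t, 0 <= f t) ->
  \esum_(t in [set: T]) (f t)%:E = s%:E -> has_sum f s.
Proof.
move=> f0 fs; exists f, (fun=> 0), s, 0; split => //.
- by move=> t; rewrite subr0.
- by rewrite esum1.
- by rewrite subr0.
Qed.

(** Turns a pointwise identity into an identity between sums: the positive and negative parts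
    coincide, hence so do their totals. *)
Lemma has_sum_eq0 f s : (forall t, f t = 0) -> has_sum f s -> s = 0.
Proof.
move=> f0 [g [h [a [b [_ fE ga hb ->]]]]].
have gh : g = h by apply/funext => t; apply/eqP; rewrite -subr_eq0 -fE f0.
by move: hb; rewrite -gh ga => -[->]; rewrite subrr.
Qed.

Lemma has_sum0 : has_sum (fun=> 0) 0.
Proof. by apply: has_sum_ge0 => //; rewrite esum1. Qed.

Lemma has_sumN f s : has_sum f s -> has_sum (fun t => - f t) (- s).
Proof.
move=> [g [h [a [b [gh0 fE ga hb ->]]]]]; exists h, g, b, a; split => //.
- by move=> t; have [] := gh0 t.
- by move=> t; rewrite fE opprB.
- by rewrite opprB.
Qed.

Lemma has_sumD f1 f2 s1 s2 : has_sum f1 s1 -> has_sum f2 s2 ->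
  has_sum (fun t => f1 t + f2 t) (s1 + s2).
Proof.
move=> [g [h [a [b [gh0 fE ga hb ->]]]]] [g' [h' [a' [b' [gh0' fE' ga' hb' ->]]]]].
exists (fun t => g t + g' t), (fun t => h t + h' t), (a + a'), (b + b'); split.
- by move=> t; have [? ?] := gh0 t; have [? ?] := gh0' t; rewrite !addr_ge0.
- by move=> t; rewrite fE fE'; ring.
- under eq_esum do rewrite EFinD.
  rewrite esumD ?ga ?ga' // => t _; rewrite lee_fin; first by have [] := gh0 t.
  by have [] := gh0' t.
- under eq_esum do rewrite EFinD.
  rewrite esumD ?hb ?hb' // => t _; rewrite lee_fin; first by have [] := gh0 t.
  by have [] := gh0' t.
- by ring.
Qed.

Lemma has_sumZ c f s : has_sum f s -> has_sum (fun t => c * f t) (c * s).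
Proof.
(* A negative [c] would exchange the roles of [g] and [h]; [has_sumN] reduces it to [- c]. *)
wlog c0 : c / 0 <= c.
  move=> H fs; have [/H|/ltW c0] := leP 0 c; first exact.
  have := has_sumN (H (- c) _ fs); rewrite oppr_ge0 mulNr opprK => /(_ c0).
  by apply: eq_has_sum => t; rewrite mulNr opprK.
move=> [g [h [a [b [gh0 fE ga hb ->]]]]].
exists (fun t => c * g t), (fun t => c * h t), (c * a), (c * b); split.
- by move=> t; have [? ?] := gh0 t; rewrite !mulr_ge0.
- by move=> t; rewrite fE mulrBr.
- under eq_esum do rewrite EFinM.
  by rewrite esumZl ?ga ?EFinM // => t; have [] := gh0 t.
- under eq_esum do rewrite EFinM.
  by rewrite esumZl ?hb ?EFinM // => t; have [] := gh0 t.
- by rewrite mulrBr.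
Qed.

Lemma has_sum_sum n (f : 'I_n -> T -> R) (s : 'I_n -> R) :
  (forall i, has_sum (f i) (s i)) ->
  has_sum (fun t => \sum_(i < n) f i t) (\sum_(i < n) s i).
Proof.
elim: n f s => [|n IHn] f s fs.
  by rewrite big_ord0; apply: eq_has_sum has_sum0 => t; rewrite big_ord0.
rewrite big_ord_recr; apply: eq_has_sum (has_sumD (IHn _ _ _) (fs ord_max)).
- by move=> t; rewrite big_ord_recr.
- by move=> i; apply: fs.
Qed.

End HasSum.

(** * Sums over pairs of indices *)

Section PairSums.
Variable R : realType.
Local Open Scope classical_set_scope.
Local Open Scope ereal_scope.

Lemma esum_mul (u v : nat -> R) (a b : R) :
    (forall n, 0 <= u n)%R -> (forall n, 0 <= v n)%R ->
    \esum_(n in [set: nat]) (u n)%:E = a%:E ->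
    \esum_(n in [set: nat]) (v n)%:E = b%:E ->
  \esum_(n in [set: nat * nat]) (u n.1 * v n.2)%:E = (a * b)%:E.
Proof.
move=> u0 v0 ua vb.
transitivity (\esum_(i in [set: nat]) \esum_(j in [set: nat]) (u i * v j)%:E).
  rewrite esum_esum; last by move=> i j _ _; rewrite lee_fin mulr_ge0.
  by congr esum; apply/seteqP; split.
under eq_esum => i _.
  under eq_esum do rewrite EFinM.
  rewrite esumZl // vb muleC; over.
have b0 : (0 <= b)%R.
  by rewrite -lee_fin -vb; apply: esum_ge0 => n _; rewrite lee_fin.
by rewrite esumZl ?ua -?EFinM 1?mulrC // => n; rewrite lee_fin.
Qed.

(** An off-diagonal region is parametrised by the smaller index and the gap minus one. Here the
    smaller index comes first, to pass from [(a, x)] to [(a, y)]; in the next two lemmas the gap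
    comes first, to pass from [y] and [x] to [(a, y)]. *)
Lemma esum_lt_pair1 (f : nat * nat -> \bar R) :
  \esum_(n in [set n | (n.1 < n.2)%N]) f n
    = \esum_(n in [set: nat * nat]) f (n.1, n.1 + n.2.+1)%N.
Proof.
apply: reindex_esum; split => [[i j] _|[i j] [i' j'] _ _ []|[i j] /= ij] /=.
- by lia.
- by move=> -> e; congr pair; lia.
- by exists (i, j - i.+1)%N => //=; congr pair; lia.
Qed.

Lemma esum_lt_pair2 (f : nat * nat -> \bar R) :
  \esum_(n in [set n | (n.1 < n.2)%N]) f n
    = \esum_(n in [set: nat * nat]) f (n.2, n.2 + n.1.+1)%N.
Proof.
apply: reindex_esum; split => [[i j] _|[i j] [i' j'] _ _ []|[i j] /= ij] /=.
- by lia.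
- by move=> -> e; congr pair; lia.
- by exists (j - i.+1, i)%N => //=; congr pair; lia.
Qed.

Lemma esum_gt_pair2 (f : nat * nat -> \bar R) :
  \esum_(n in [set n | (n.2 < n.1)%N]) f n
    = \esum_(n in [set: nat * nat]) f (n.2 + n.1.+1, n.2)%N.
Proof.
apply: reindex_esum; split => [[i j] _|[i j] [i' j'] _ _ []|[i j] /= ij] /=.
- by lia.
- by move=> e e'; congr pair; lia.
- by exists (i - j.+1, j)%N => //=; congr pair; lia.
Qed.

Lemma esum_diag_pair (f : nat * nat -> \bar R) :
  \esum_(n in [set n | n.1 = n.2]) f n = \esum_(n in [set: nat]) f (n, n).
Proof.
apply: reindex_esum; split => [i _|i j _ _ []|[i j] /= ij] //=.
by exists i => //; rewrite ij.
Qed.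

Lemma esum_split_le (f : nat * nat -> \bar R) : (forall n, 0 <= f n) ->
  \esum_(n in [set: nat * nat]) f n
    = \esum_(n in [set n | (n.2 <= n.1)%N]) f n
      + \esum_(n in [set n | (n.1 < n.2)%N]) f n.
Proof.
move=> f0; rewrite (esumID [set n | (n.2 <= n.1)%N]) // !setTI.
by congr (_ + _); congr esum; apply/seteqP; split => n /=; lia.
Qed.

Lemma esum_split_lt (f : nat * nat -> \bar R) : (forall n, 0 <= f n) ->
  \esum_(n in [set n | (n.2 <= n.1)%N]) f n
    = \esum_(n in [set n | n.1 = n.2]) f n
      + \esum_(n in [set n | (n.2 < n.1)%N]) f n.
Proof.
move=> f0; rewrite (esumID [set n | n.1 = n.2]) //.
by congr (_ + _); congr esum; apply/seteqP; split => n /=; lia.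
Qed.

End PairSums.

(** * Zeta, t- and T-values as sums over pairs *)

Section ZetaSums.
Variable R : realType.
Local Open Scope classical_set_scope.
Implicit Types k l : nat.

Definition halfint (n : nat) : R := n%:R + 2^-1.

Lemma halfint_gt0 n : 0 < halfint n.
Proof. by rewrite ltr_wpDl // invr_gt0. Qed.

Lemma invX_ge0 (x : R) k : 0 <= x -> 0 <= x ^- k.
Proof. by move=> x0; rewrite invr_ge0 exprn_ge0. Qed.

Lemma halfint_invX_ge0 n k : 0 <= halfint n ^- k.
Proof. exact/invX_ge0/ltW/halfint_gt0. Qed.

Lemma nat_invX_ge0 n k : 0 <= n%:R ^- k :> R.
Proof. exact/invX_ge0/ler0n. Qed.

Lemma esum_halfint_invX_lty k : (2 <= k)%N ->
  (\esum_(n in [set: nat]) (halfint n ^- k)%:E < +oo)%E.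
Proof.
(* Comparison with a telescoping series: the increments of [f] are [2^k * 2 / ((n+1)(n+2))], and the
   bound reduces to [(n+1)(n+2) <= 2 (2n+1)^2], an equality at [n = 0]. *)
move=> k2; pose f n : R := - (2 ^+ k * 2) * n.+1%:R^-1.
have f_cvg : f @ \oo --> (- (2 ^+ k * 2) * 0 : R).
  by apply: cvgMr; exact: cvg_harmonic.
have f_mono : {homo f : i j / (i <= j)%N >-> i <= j}.
  move=> i j ij; rewrite /f !mulNr lerN2 ler_wpM2l //.
  by rewrite lef_pV2 ?posrE // ler_nat.
apply: (@le_lt_trans _ _ (\esum_(n in [set: nat]) ((f n.+1)%:E - (f n)%:E))%E).
  apply: le_esum => n _; rewrite -EFinB lee_fin.
  have h0 := halfint_gt0 n.
  have h1 : 1 <= 2 * halfint n by rewrite /halfint mulrDr divff // lerDr mulr_ge0.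
  have -> : f n.+1 - f n = 2 ^+ k * (2 / (n.+1%:R * n.+2%:R)).
    have : n.+1%:R != 0 :> R by rewrite pnatr_eq0.
    have : n.+2%:R != 0 :> R by rewrite pnatr_eq0.
    rewrite /f -(natr1 n.+1); move: (n.+1%:R : R) => z z1 z0.
    by field; rewrite z1 z0.
  rewrite -(@ler_pM2l _ (2 ^- k)) ?invr_gt0 ?exprn_gt0 // mulKf ?expf_neq0 //.
  rewrite -invfM -exprMn.
  apply: (@le_trans _ _ ((2 * halfint n) ^- 2)).
    by rewrite lef_pV2 ?posrE ?exprn_gt0 ?mulr_gt0 // ler_weXn2l.
  rewrite ler_pdivlMr ?mulr_gt0 // mulrC ler_pdivrMr ?exprn_gt0 ?mulr_gt0 //.
  rewrite /halfint -(natr1 n.+1) -(natr1 n); have : 0 <= n%:R :> R by []; nra.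
rewrite -nneseries_esumT; last first.
  by move=> n; rewrite -EFinB lee_fin subr_ge0 f_mono.
rewrite nondecreasing_telescope_sumey //.
  by rewrite EFin_lim ?ltry //; apply/cvg_ex; eexists; exact: f_cvg.
by rewrite EFin_lim //; apply/cvg_ex; eexists; exact: f_cvg.
Qed.

Lemma esum_nat_invX_lty k : (2 <= k)%N ->
  (\esum_(n in [set: nat]) (n.+1%:R ^- k)%:E < +oo :> \bar R)%E.
Proof.
move=> k2; apply: le_lt_trans (esum_halfint_invX_lty k2).
apply: le_esum => n _; rewrite lee_fin lef_pV2 ?posrE ?exprn_gt0 ?halfint_gt0 //.
rewrite lerXn2r ?nnegrE ?(ltW (halfint_gt0 n)) //.
by rewrite /halfint -(natr1 n) lerD2l invf_le1 // ler1n.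
Qed.

(** Links unordered extended sums to the real limits that define [zeta] and [ttilde]; finiteness
    lets the limit commute with [EFin]. *)
Lemma esum_succ_series (v : nat -> R) : (forall n, 0 <= v n) ->
    (\esum_(n in [set: nat]) (v n.+1)%:E < +oo)%E ->
  \esum_(n in [set: nat]) (v n.+1)%:E = (\big[+%R/0]_(1 <= n <oo) v n)%:E.
Proof.
move=> v0; rewrite -nneseries_esumT => [|n]; last by rewrite lee_fin.
have -> : (\sum_(0 <= n <oo) (v n.+1)%:E = \sum_(1 <= n <oo) (v n)%:E)%E.
  rewrite -(@nneseries_addn _ (EFin \o v)) => [|n]; last by rewrite lee_fin.
  by apply: eq_eseriesr => n _ /=; rewrite addn1.
move=> vfin; rewrite -EFin_lim.
  by congr (limn _); apply/funext => n /=; rewrite sumEFin.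
(* The convergence criterion concerns the series from 0, so the finite term [v 0] is put back. *)
rewrite is_cvg_series_restrict; apply: nnseries_is_cvg => //.
rewrite nneseries_recl // => [|n]; last by rewrite lee_fin.
by rewrite lte_add_pinfty // ltry.
Qed.

Lemma esum_zeta k : (2 <= k)%N ->
  \esum_(n in [set: nat]) (n.+1%:R ^- k)%:E = (zeta (k%:R : R))%:E.
Proof.
move=> k2; have E n : n%:R ^- k = n%:R `^ (- k%:R) :> R.
  by rewrite powRN powR_mulrn.
rewrite -esum_succ_series => [|n|].
- by apply: eq_esum => n _; rewrite E.
- exact: powR_ge0.
- by under eq_esum do rewrite -E; exact: esum_nat_invX_lty.
Qed.

Lemma esum_ttilde k : (2 <= k)%N ->
  \esum_(n in [set: nat]) (halfint n ^- k)%:E = (ttilde (k%:R : R))%:E.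
Proof.
move=> k2; have E n : halfint n ^- k = (n.+1%:R - 2^-1) `^ (- k%:R) :> R.
  have -> : n.+1%:R - 2^-1 = halfint n by rewrite /halfint -(natr1 n); field.
  by rewrite powRN powR_mulrn // ltW // halfint_gt0.
rewrite -(@esum_succ_series (fun n => (n%:R - 2^-1) `^ (- k%:R))) => [|n|].
- by apply: eq_esum => n _; rewrite E.
- exact: powR_ge0.
- by under eq_esum do rewrite -E; exact: esum_halfint_invX_lty.
Qed.


Lemma esum_zeta_ttilde k l : (2 <= k)%N -> (2 <= l)%N ->
  \esum_(n in [set: nat * nat]) (n.1.+1%:R ^- k * halfint n.2 ^- l)%:E
    = (zeta (k%:R : R) * ttilde (l%:R : R))%:E.
Proof.
move=> k2 l2; apply: (@esum_mul _ (fun n => n.+1%:R ^- k) (fun n => halfint n ^- l));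
  [| |exact: esum_zeta|exact: esum_ttilde] => n.
  exact: nat_invX_ge0.
exact: halfint_invX_ge0.
Qed.

Lemma esum_ttilde_ttilde k l : (2 <= k)%N -> (2 <= l)%N ->
  \esum_(n in [set: nat * nat]) (halfint n.1 ^- k * halfint n.2 ^- l)%:E
    = (ttilde (k%:R : R) * ttilde (l%:R : R))%:E.
Proof.
move=> k2 l2; apply: (@esum_mul _ (fun n => halfint n ^- k) (fun n => halfint n ^- l));
  [| |exact: esum_ttilde..] => n; exact: halfint_invX_ge0.
Qed.

(** Put [n1 = n.1 + 2] and [n2 = n.2 + 1]: the denominators become [2 (n.1 + 1)] and
    [2 (n.2 + 1/2)], which accounts for the power of 2, and [n1 > n2] says that the half-integer
    lies below the integer. *)
Lemma doubleTE k l :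
    \esum_(n in [set n : nat * nat | (n.2 <= n.1)%N])
      (n.1.+1%:R ^- k * halfint n.2 ^- l)%:E \is a fin_num ->
  (\esum_(n in [set n : nat * nat | (n.2 <= n.1)%N])
    (n.1.+1%:R ^- k * halfint n.2 ^- l)%:E)
  = (2 ^+ (k + l) / 4 * doubleT R k l)%:E.
Proof.
move=> Sfin; rewrite -[LHS]fineK //; congr EFin.
apply: (@mulfI _ (4 / 2 ^+ (k + l))).
  by rewrite mulf_neq0 // invr_eq0 expf_neq0.
have -> : 4 / 2 ^+ (k + l) * (2 ^+ (k + l) / 4 * doubleT R k l) = doubleT R k l.
  by rewrite mulrA mulf_div [4 * _]mulrC divff ?mul1r // mulf_neq0 // expf_neq0.
rewrite /doubleT -mulrA; congr (_ * _).
rewrite [in RHS](@reindex_esum _ _ _ [set n : nat * nat | (n.2 <= n.1)%N] _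
   (fun n => (n.1.+2, n.2.+1))%N); last first.
  split => [[i j] /= ij|[i j] [i' j'] _ _ [-> ->] //|[i j] /= ij]; first by lia.
  by exists (i.-2, j.-1) => /=; [lia|congr pair; lia].
rewrite -[X in X * _ = _]/(fine ((2 ^+ (k + l))^-1)%:E) -fineM //.
rewrite -esumZl ?invr_ge0 ?exprn_ge0 //; last first.
  by move=> n; rewrite lee_fin mulr_ge0 ?halfint_invX_ge0 ?nat_invX_ge0.
congr fine; apply: eq_esum => n _ /=.
have -> : 2 * n.1.+2%:R - 2 = 2 * n.1.+1%:R :> R by rewrite -(natr1 n.1.+1); ring.
have -> : 2 * n.2.+1%:R - 1 = 2 * halfint n.2 :> R.
  by rewrite /halfint -(natr1 n.2); field.
by rewrite -EFinM !exprMn mulrACA -exprD !invfM.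
Qed.

Lemma has_sum_zeta_ttilde k l : (2 <= k)%N -> (2 <= l)%N ->
  has_sum (fun n : nat * nat => n.1.+1%:R ^- k * halfint n.2 ^- l)
    (zeta (k%:R : R) * ttilde (l%:R : R)).
Proof.
move=> k2 l2; apply: has_sum_ge0; last exact: esum_zeta_ttilde.
by move=> n; rewrite mulr_ge0 ?halfint_invX_ge0 ?nat_invX_ge0.
Qed.

(** The product of [zeta] and [ttilde] runs over all integers [a] and half-integers [x]. The part
    [x < a] is the double T-value; in the part [x > a] one writes [x = a + y]. *)
Lemma has_sum_doubleT k l : (2 <= k)%N -> (2 <= l)%N ->
  has_sum (fun n : nat * nat => n.1.+1%:R ^- k * (n.1.+1%:R + halfint n.2) ^- l)
    (zeta (k%:R : R) * ttilde (l%:R : R) - 2 ^+ (k + l) / 4 * doubleT R k l).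
Proof.
move=> k2 l2; have f0 (n : nat * nat) : 0 <= n.1.+1%:R ^- k * halfint n.2 ^- l.
  by rewrite mulr_ge0 ?halfint_invX_ge0 ?nat_invX_ge0.
apply: has_sum_ge0 => [n|].
  by rewrite mulr_ge0 ?nat_invX_ge0 // invX_ge0 // addr_ge0 // ltW // halfint_gt0.
have := esum_zeta_ttilde k2 l2; rewrite esum_split_le => [|n]; last first.
  by rewrite lee_fin.
rewrite (esum_lt_pair1 (fun n => (n.1.+1%:R ^- k * halfint n.2 ^- l)%:E)) /=.
under [X in (_ + X)%E]eq_esum => n _.
  have -> : halfint (n.1 + n.2.+1) = n.1.+1%:R + halfint n.2.
    by rewrite /halfint addnS -addSn natrD addrA.
  over.
set S := (X in (X + _)%E); set U := (X in (_ + X)%E) => SU.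
have : (S + U \is a fin_num)%E by rewrite SU.
rewrite fin_numD => /andP[/doubleTE SE Ufin].
move: SU; rewrite -(fineK Ufin) /S SE -EFinD => -[<-].
by rewrite addrAC subrr add0r fineK.
Qed.

(* A pair [n] stands for the half-integers [y = n.2 + 1/2] and [x = a + y],
   where [a = n.1 + 1], so this is the sum over [0 < y < x]. *)
Definition ttilde2 k l : R :=
  fine (\esum_(n in [set: nat * nat]) (halfint n.2 ^- k * halfint (n.2 + n.1.+1) ^- l)%:E).

(** The stuffle product: the double sum splits into its diagonal and the two sides of it. Finiteness
    is recorded because [ttilde2] is defined through [fine]. *)
Lemma ttilde_ttildeE k l : (2 <= k)%N -> (2 <= l)%N ->
  [/\ \esum_(n in [set: nat * nat]) (halfint n.2 ^- k * halfint (n.2 + n.1.+1) ^- l)%:E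
        \is a fin_num
    & ttilde (k%:R : R) * ttilde (l%:R : R)
        = ttilde ((k + l)%:R : R) + ttilde2 l k + ttilde2 k l].
Proof.
move=> k2 l2.
have f0 (n : nat * nat) : (0 <= (halfint n.1 ^- k * halfint n.2 ^- l)%:E)%E.
  by rewrite lee_fin mulr_ge0 ?halfint_invX_ge0.
have := esum_ttilde_ttilde k2 l2; rewrite esum_split_le // esum_split_lt //.
rewrite (esum_lt_pair2 (fun n => (halfint n.1 ^- k * halfint n.2 ^- l)%:E)) /=.
rewrite (esum_gt_pair2 (fun n => (halfint n.1 ^- k * halfint n.2 ^- l)%:E)) /=.
rewrite (esum_diag_pair (fun n => (halfint n.1 ^- k * halfint n.2 ^- l)%:E)) /=.
under [X in (X + _ + _)%E]eq_esum do rewrite -invfM -exprD.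
rewrite esum_ttilde; last by rewrite (leq_trans k2) ?leq_addr.
under [X in (_ + X + _)%E]eq_esum do rewrite mulrC.
set U := (X in (_ + X + _)%E); set V := (X in (_ + X)%E) => UV.
have : ((ttilde (k + l)%:R)%:E + U + V \is a fin_num)%E by rewrite UV.
rewrite fin_numD => /andP[]; rewrite fin_numD => /andP[_ Ufin] Vfin.
split => //; move: UV; rewrite -(fineK Ufin) -(fineK Vfin) -!EFinD.
by case=> <-.
Qed.


Lemma has_sum_ttilde2 k l : (2 <= k)%N -> (2 <= l)%N ->
  has_sum (fun n : nat * nat => halfint n.2 ^- k * (n.1.+1%:R + halfint n.2) ^- l)
    (ttilde2 k l).
Proof.
move=> k2 l2; have [Vfin _] := ttilde_ttildeE k2 l2.
apply: has_sum_ge0 => [n|].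
  rewrite mulr_ge0 ?halfint_invX_ge0 // invX_ge0 // addr_ge0 // ltW //.
  exact: halfint_gt0.
rewrite /ttilde2 fineK //; apply: eq_esum => n _.
by rewrite /halfint addnC natrD -addrA.
Qed.

Lemma doubleT_relation p q m : (2 <= p)%N -> (2 <= q)%N -> (2 <= m)%N ->
  (-1) ^+ m * (\sum_(i < p)
      'C(m + i - 1, i)%:R * 'C(q + (p - 1 - i) - 1, p - 1 - i)%:R
        * (zeta ((m + i)%:R : R) * ttilde ((q + (p - 1 - i))%:R : R)
           - 2 ^+ (p + q + m - 1) / 4 * doubleT R (m + i) (q + (p - 1 - i))))
  + \sum_(i < m)
      'C(p + i - 1, i)%:R * 'C(q + (m - 1 - i) - 1, m - 1 - i)%:R
        * ((-1) ^+ i * (zeta ((p + i)%:R : R) * ttilde ((q + (m - 1 - i))%:R : R)))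
  = \sum_(i < q)
      'C(m + i - 1, i)%:R * 'C(p + (q - 1 - i) - 1, q - 1 - i)%:R
        * ttilde2 (m + i) (p + (q - 1 - i)).
Proof.
move=> p2 q2 m2; apply/eqP; rewrite -subr_eq0; apply/eqP.
pose a (n : nat * nat) : R := n.1.+1%:R.
pose y (n : nat * nat) : R := halfint n.2.
apply: (@has_sum_eq0 _ _ (fun n => (-1) ^+ m * pfcoef p (a n) m (a n + y n) q
  + (-1) ^+ p * pfcoef m (- a n) p (y n) q - pfcoef q (y n) m (a n + y n) p)).
  move=> n; have a0 : 0 < a n by rewrite ltr0n.
  have y0 : 0 < y n := halfint_gt0 n.2.
  rewrite (partial_fractions _ _ _ _ _ (erefl (a n + y n))) ?subrr //;
    by rewrite gt_eqF // addr_gt0.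
(* All exponents that occur are at least 2, so each summand converges absolutely and the family can
   be summed term by term. *)
apply: has_sumD; first apply: has_sumD.
- apply/has_sumZ/has_sum_sum => i; apply: has_sumZ.
  (* The weight does not depend on [i], hence neither does the power of 2 in front of [doubleT]. *)
  have -> : (p + q + m - 1 = (m + i) + (q + (p - 1 - i)))%N.
    by have := ltn_ord i; lia.
  by apply: has_sum_doubleT; lia.
- apply: (@eq_has_sum _ _ (fun n => \sum_(i < m)
     'C(p + i - 1, i)%:R * 'C(q + (m - 1 - i) - 1, m - 1 - i)%:R
        * ((-1) ^+ i * (a n ^- (p + i) * y n ^- (q + (m - 1 - i)))))).
    move=> n; rewrite /pfcoef mulr_sumr; apply: eq_bigr => i _.
    rewrite [RHS]mulrCA; congr (_ * _); rewrite mulrA [in RHS]mulrA; congr (_ * _).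
    (* The prefactor [(-1)^p] cancels against the sign [(-1)^(p + i)] of [(- a)^-(p + i)] and leaves
       [(-1)^i]. *)
    rewrite -[- a n]mulN1r exprMn invfM mulrA; congr (_ * _).
    by rewrite -exprVn invrN1 exprD mulrA -expr2 sqrr_sign mul1r.
  apply: has_sum_sum => i; do 2!apply: has_sumZ.
  by apply: has_sum_zeta_ttilde; lia.
- apply/has_sumN/has_sum_sum => i; apply: has_sumZ.
  by apply: has_sum_ttilde2; lia.
Qed.

End ZetaSums.

(** * Combination of the two relations *)

Theorem theorem5p3 (R : realType) (p q m : nat)
    (hp : (2 <= p)%N) (hq : (2 <= q)%N) (hm : (2 <= m)%N) :
  (-1) ^+ m * (\sum_(i < p)
      'C(m + i - 1, i)%:R * 'C(q + (p - 1 - i) - 1, p - 1 - i)%:R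
        * doubleT R (m + i) (q + (p - 1 - i)))
  + (-1) ^+ p * (\sum_(i < m)
      'C(p + i - 1, i)%:R * 'C(q + (m - 1 - i) - 1, m - 1 - i)%:R
        * doubleT R (p + i) (q + (m - 1 - i)))
  = 1 / 2 ^+ (p + q + m - 3) * 'C(p + q + m - 2, q - 1)%:R
      * ttilde ((p + q + m - 1)%:R : R)
  + 1 / 2 ^+ (p + q + m - 3) * (\sum_(i < p)
      'C(m + i - 1, i)%:R * 'C(q + (p - 1 - i) - 1, p - 1 - i)%:R
        * ((-1) ^+ i + (-1) ^+ m)
        * zeta ((m + i)%:R : R) * ttilde ((q + (p - 1 - i))%:R : R))
  + 1 / 2 ^+ (p + q + m - 3) * (\sum_(i < m)
      'C(p + i - 1, i)%:R * 'C(q + (m - 1 - i) - 1, m - 1 - i)%:R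
        * ((-1) ^+ i + (-1) ^+ p)
        * zeta ((p + i)%:R : R) * ttilde ((q + (m - 1 - i))%:R : R))
  - 1 / 2 ^+ (p + q + m - 3) * (\sum_(i < q)
      'C(m + i - 1, i)%:R * 'C(p + (q - 1 - i) - 1, q - 1 - i)%:R
        * ttilde ((m + i)%:R : R) * ttilde ((p + (q - 1 - i))%:R : R)).
Proof.
have r1 := doubleT_relation R hp hq hm.
have := doubleT_relation R hm hq hp.
have -> : (m + q + p - 1 = p + q + m - 1)%N by lia.
move=> r2.
have rTT : \sum_(i < q)
      'C(m + i - 1, i)%:R * 'C(p + (q - 1 - i) - 1, q - 1 - i)%:R
        * ttilde ((m + i)%:R : R) * ttilde ((p + (q - 1 - i))%:R : R)
  = 'C(p + q + m - 2, q - 1)%:R * ttilde ((p + q + m - 1)%:R : R)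
  + \sum_(i < q) 'C(m + i - 1, i)%:R * 'C(p + (q - 1 - i) - 1, q - 1 - i)%:R
        * ttilde2 R (m + i) (p + (q - 1 - i))
  + \sum_(i < q) 'C(p + i - 1, i)%:R * 'C(m + (q - 1 - i) - 1, q - 1 - i)%:R
        * ttilde2 R (p + i) (m + (q - 1 - i)).
  (* Reversing the last sum aligns its terms with the first, so that the stuffle product applies for
     each [i]. *)
  rewrite [X in _ = _ + X](reindex_inj rev_ord_inj) /=.
  have -> : 'C(p + q + m - 2, q - 1)%:R = \sum_(i < q)
      'C(m + i - 1, i)%:R * 'C(p + (q - 1 - i) - 1, q - 1 - i)%:R :> R.
    case: q hq {r1 r2} => // q _; rewrite subSS subn0 sum_bin_mul.
    by congr ('C(_, _)%:R); lia.
  rewrite mulr_suml -!big_split; apply: eq_bigr => i _ /=.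
  have lt_iq := ltn_ord i.
  have -> : (q - i.+1 = q - 1 - i)%N by lia.
  have -> : (q - 1 - (q - 1 - i) = i)%N by lia.
  have -> : (p + q + m - 1 = (m + i) + (p + (q - 1 - i)))%N by lia.
  rewrite -mulrA (ttilde_ttildeE R _ _).2; [ring|lia|lia].
(* The diagonal cancels the single [ttilde] term of the goal, and [r1] and [r2] eliminate the
   [ttilde2] sums. Each zeta-ttilde sum then occurs once with the sign [(-1)^i] and once with
   [(-1)^m] or [(-1)^p]. *)
rewrite rTT -r1 -r2.
have eN : 2 ^+ (p + q + m - 1) / 4 = 2 ^+ (p + q + m - 3) :> R.
  have -> : (p + q + m - 1 = (p + q + m - 3) + 2)%N by lia.
  by rewrite exprD -[4]/((2 * 2)%:R) natrM -expr2 mulfK // expf_neq0.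
have sumB n (c z d : 'I_n -> R) w : \sum_(i < n) c i * (z i - w * d i)
    = \sum_(i < n) c i * z i - w * \sum_(i < n) c i * d i.
  by rewrite mulr_sumr -sumrB; apply: eq_bigr => i _; ring.
have sumD n (c z t : 'I_n -> R) e :
    \sum_(i < n) c i * ((-1) ^+ i + e) * z i * t i
    = \sum_(i < n) c i * ((-1) ^+ i * (z i * t i))
      + e * \sum_(i < n) c i * (z i * t i).
  by rewrite mulr_sumr -big_split; apply: eq_bigr => i _ /=; ring.
rewrite !eN !sumB !sumD.
have : 2 ^+ (p + q + m - 3) != 0 :> R by rewrite expf_neq0.
move: (2 ^+ _) => W W0.
by field.
Qed.
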